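(* Let $u_L:[m]\times[n]\to[-1,1]$ be a learner payoff satisfying the standing assumptions. The no-swap-regret menu $\mathcal{M}_{NSR}$ is a Pareto-optimal asymptotic menu.
   Context: The optimizer has action set $[m]$ and the learner has action set $[n]$. $\Delta_k$ is the simplex over $[k]$; $\Delta_{mn}$ is the set of probability distributions over $[m]\times[n]$, whose elements are called correlated strategy profiles (CSPs). $x\otimes y$ is the product distribution. Payoffs $u_L,u_O:[m]\times[n]\to[-1,1]$ are extended (multi)linearly to $\Delta_m\times\Delta_n$ and to $\Delta_{mn}$. $\mathrm{BR}_L(x)=\arg\max_{j\in[n]}u_L(x,j)$. Standing assumptions on $u_L$: (1) there is a unique pair $(i^*,j^* )\in[m]\times[n]$ maximizing $u_L$; (2) the learner has no weakly dominated action, i.e. every $j\in[n]$ for which some $x\in\Delta_m$ has $j\in\mathrm{BR}_L(x)$ also admits some $x'\in\Delta_m$ with $\mathrm{BR}_L(x')=\{j\}$. Asymptotic menus. A learning algorithm $\mathcal{A}=\{A^T\}_{T\in\mathbb{N}}$ consists, for each horizon $T$, of functions $A^T_t:\Delta_m^{t-1}\to\Delta_n$; against $(x_1,\dots,x_T)\in\Delta_m^T$ the learner plays $y_t=A^T_t(x_1,\dots,x_{t-1})$. $\mathcal{M}(A^T)$ is the convex hull of all points $\frac1T\sum_{t=1}^T x_t\otimes y_t$ over all optimizer sequences. If $\mathcal{M}(A^1),\mathcal{M}(A^2),\dots$ converges in the Hausdorff metric, the (closed) limit is the asymptotic menu of $\mathcal{A}$. A subset of $\Delta_{mn}$ is an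 asymptotic menu if it arises this way from some learning algorithm. Pareto-optimality. For an asymptotic menu $\mathcal{M}$ and optimizer payoff $u_O$, $V_L(\mathcal{M},u_O)=\max\{u_L(\varphi)\mid\varphi\in\arg\max_{\varphi\in\mathcal{M}}u_O(\varphi)\}$. An asymptotic menu $\mathcal{M}'$ Pareto-dominates $\mathcal{M}$ if $V_L(\mathcal{M}',u_O)\ge V_L(\mathcal{M},u_O)$ for all $u_O:[m]\times[n]\to[-1,1]$, with strict inequality for at least one $u_O$. An asymptotic menu is Pareto-optimal if no asymptotic menu Pareto-dominates it. $\mathcal{M}_{NSR}$ is the convex hull of all no-swap-regret CSPs, i.e. CSPs $\varphi$ with $\sum_{i}\varphi_{ij}u_L(i,j)\ge\max_{j'\in[n]}\sum_{i}\varphi_{ij}u_L(i,j')$ for each $j\in[n]$. *)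

(* Defs.v *)
From mathcomp Require Import all_boot all_order all_algebra.
From mathcomp Require Import all_classical all_reals all_analysis.

Set Implicit Arguments.
Unset Strict Implicit.
Unset Printing Implicit Defensive.

Import Order.TTheory GRing.Theory Num.Theory.
Import numFieldNormedType.Exports.

Local Open Scope classical_set_scope.
Local Open Scope ring_scope.

Section Defs.
Variable R : realType.

Definition simplex (k : nat) : set 'rV[R]_k :=
  [set x | (forall i, 0 <= x ord0 i) /\ \sum_i x ord0 i = 1].

Definition convex_hull (V : lmodType R) (S : set V) : set V :=
  smallest (@convex_set R V) S.

(* The value is +oo when one set lies in no neighbourhood of the other. *)
Definition hausdorff_dist (V : pseudoMetricType R) (X Y : set V) : \bar R :=
  ereal_inf [set e%:E | e in [set e : R | [/\ 0 < e,
    X `<=` \bigcup_(y in Y) ball y e & Y `<=` \bigcup_(x in X) ball x e]]].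

Section Game.
Variables m n : nat.

(* A correlated strategy profile is an m x n matrix of probabilities. *)
Definition csp : set 'M[R]_(m, n) :=
  [set phi | (forall i j, 0 <= phi i j) /\ \sum_i \sum_j phi i j = 1].

Definition prod_dist (x : 'rV[R]_m) (y : 'rV[R]_n) : 'M[R]_(m, n) :=
  \matrix_(i, j) (x ord0 i * y ord0 j).

Definition is_payoff (u : 'I_m -> 'I_n -> R) : Prop :=
  forall i j, -1 <= u i j <= 1.

Definition payoff (u : 'I_m -> 'I_n -> R) (phi : 'M[R]_(m, n)) : R :=
  \sum_i \sum_j phi i j * u i j.

Definition payoff_vs_action (u : 'I_m -> 'I_n -> R) (x : 'rV[R]_m) (j : 'I_n)
    : R :=
  \sum_i x ord0 i * u i j.

Definition best_responses (u : 'I_m -> 'I_n -> R) (x : 'rV[R]_m) : set 'I_n :=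
  [set j | forall j', payoff_vs_action u x j' <= payoff_vs_action u x j].

Definition unique_maximizer (u : 'I_m -> 'I_n -> R) : Prop :=
  exists! p : 'I_m * 'I_n, forall i j, u i j <= u p.1 p.2.

Definition no_weakly_dominated_action (u : 'I_m -> 'I_n -> R) : Prop :=
  forall j, (exists2 x, simplex x & best_responses u x j) ->
    exists2 x', simplex x' & best_responses u x' = [set j].

(* [A T s] is the learner's move, for horizon [T], after the optimizer's moves
   [s]; the round is [(size s).+1], so values at [size s >= T] are
   irrelevant. *)
Definition learning_algorithm (A : nat -> seq 'rV[R]_m -> 'rV[R]_n) : Prop :=
  forall T s, (size s < T)%N -> (forall x, x \in s -> simplex x) ->
    simplex (A T s).

Definition average_play (A : nat -> seq 'rV[R]_m -> 'rV[R]_n) (T : nat)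
    (x : T.-tuple 'rV[R]_m) : 'M[R]_(m, n) :=
  T%:R^-1 *: \sum_(t < T) prod_dist (tnth x t) (A T (take t x)).

Definition menu (A : nat -> seq 'rV[R]_m -> 'rV[R]_n) (T : nat)
    : set 'M[R]_(m, n) :=
  convex_hull [set average_play A x |
    x in [set x : T.-tuple 'rV[R]_m | forall t, simplex (tnth x t)]].

Definition asymptotic_menu (M : set 'M[R]_(m, n)) : Prop :=
  closed M /\ exists2 A, learning_algorithm A &
    hausdorff_dist (menu A T) M @[T --> \oo] --> 0%E.

Definition maximizers (u : 'I_m -> 'I_n -> R) (M : set 'M[R]_(m, n))
    : set 'M[R]_(m, n) :=
  [set phi | M phi /\ forall psi, M psi -> payoff u psi <= payoff u phi].

(* Asymptotic menus are nonempty and compact, so this supremum is a maximum. *)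
Definition VL (uL : 'I_m -> 'I_n -> R) (M : set 'M[R]_(m, n))
    (uO : 'I_m -> 'I_n -> R) : R :=
  sup [set payoff uL phi | phi in maximizers uO M].

Definition pareto_dominates (uL : 'I_m -> 'I_n -> R)
    (M' M : set 'M[R]_(m, n)) : Prop :=
  (forall uO, is_payoff uO -> VL uL M uO <= VL uL M' uO) /\
  (exists2 uO, is_payoff uO & VL uL M uO < VL uL M' uO).

Definition pareto_optimal (uL : 'I_m -> 'I_n -> R) (M : set 'M[R]_(m, n))
    : Prop :=
  ~ exists2 M', asymptotic_menu M' & pareto_dominates uL M' M.

Definition no_swap_regret (uL : 'I_m -> 'I_n -> R) : set 'M[R]_(m, n) :=
  [set phi | csp phi /\ forall j j' : 'I_n,
    \sum_i phi i j * uL i j' <= \sum_i phi i j * uL i j].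

Definition nsr_menu (uL : 'I_m -> 'I_n -> R) : set 'M[R]_(m, n) :=
  convex_hull (no_swap_regret uL).

End Game.
End Defs.

(* Main.v *)
Require Import Defs.
From mathcomp Require Import all_boot all_order all_algebra.
From mathcomp Require Import all_classical all_reals all_analysis.
From mathcomp Require Import ring lra.

(**
  No-swap-regret is cut out by linear inequalities, so the menu is already
  convex, compact and equal to the set of no-swap-regret profiles.

  It is an asymptotic menu because of regret matching: the learner plays a
  stationary distribution of the chain whose rates are the positive parts of the
  cumulative swap regrets, so the squared norm of these positive parts grows
  linearly in time. Conversely, against a constant strategy [x] with a unique
  best response [j] such a learner must play almost always [j]; since no action
  is weakly dominated, the profiles [x (x) j] of this kind generate all
  no-swap-regret profiles by closure and convexity.

  Let [M'] dominate. For a payoff [w] and [t >= 0], the learner's value at the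
  optimizer payoff [w + t uL] is the slope in [t] of the support function of the
  menu, so domination makes the difference of the two support functions
  nondecreasing in [t]; it is nonpositive for large [t] because the maximizer of
  [uL] is unique. At [t = 0], with [w] a swap regret, this shows that [M'] is
  contained in the no-swap-regret menu. By the constant-strategy argument an
  asymptotic menu inside it is all of it, so nothing is strictly improved.
*)

Set Implicit Arguments.
Unset Strict Implicit.
Unset Printing Implicit Defensive.

Import Order.TTheory GRing.Theory Num.Theory.
Import numFieldNormedType.Exports.

Local Open Scope classical_set_scope.
Local Open Scope ring_scope.

(** * Convex sets and convex hulls *)

Section Convexity.
Context {R : realType} {V : lmodType R}.
Implicit Type C : set V.

(** Trades the interval-typed weight and boolean membership of [convex_set] for a plain real [t]. *)
Lemma convex_setP C : @convex_set R V C <->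
  (forall x y (t : R), 0 <= t -> t <= 1 -> C x -> C y ->
    C (t *: x + (1 - t) *: y)).
Proof.
split=> [cC x y t t0 t1 /mem_set Cx /mem_set Cy | cC x y t].
  have t01 : Itv.spec (@Itv.num_sem R) (Itv.Real `[0, 1]%Z) t.
    by rewrite /Itv.num_sem /= ger0_real //= in_itv /= t0 t1.
  by have := cC x y (Itv.mk t01) Cx Cy; rewrite inE.
rewrite !inE => Cx Cy; exact: cC.
Qed.

(** Induction on normalised partial sums: a new index enters with weight [l i / (l i + S)].
    Membership is asked only at positive weights, so that undefined conditional distributions are
    harmless later. *)
Lemma convex_set_sum C (I : finType) (l : I -> R) (f : I -> V) :
  @convex_set R V C -> (forall i, 0 <= l i) -> \sum_i l i = 1 ->
  (forall i, 0 < l i -> C (f i)) -> C (\sum_i l i *: f i).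
Proof.
move=> /convex_setP cC l0 l1 Cf.
have: 0 < \sum_i l i -> C ((\sum_i l i)^-1 *: \sum_i l i *: f i).
  elim: (index_enum I) => [|i s IH]; first by rewrite !big_nil ltxx.
  rewrite !big_cons; set S := \sum_(j <- s) l j.
  have S0 : 0 <= S by apply: sumr_ge0.
  have [li0|li0] := eqVneq (l i) 0; first by rewrite li0 scale0r !add0r.
  have {}li0 : 0 < l i by rewrite lt_neqAle eq_sym li0 l0.
  move=> SS; have := Cf i li0 => Ci.
  have [Se|Sn] := eqVneq S 0.
    rewrite Se addr0 big_seq big1 ?addr0 ?scalerA ?mulVf ?scale1r ?gt_eqF//.
    move=> j js; move/eqP: Se; rewrite /S psumr_eq0// => /allP /(_ j js) /eqP ->.
    by rewrite scale0r.
  have Sp : 0 < S by rewrite lt_neqAle eq_sym Sn S0.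
  have := cC (f i) _ (l i / (l i + S)) _ _ Ci (IH Sp).
  rewrite divr_ge0 ?ler_pdivrMr ?mul1r ?lerDl ?l0// ?addr_ge0 ?l0// => /(_ isT S0).
  congr (C _); rewrite scalerDr !scalerA -/S; congr (_ *: _ + _ *: _).
    by rewrite mulrC.
  by field; rewrite !lt0r_neq0.
by rewrite l1 invr1 scale1r; apply.
Qed.

Lemma convex_hull_convex (S : set V) : @convex_set R V (convex_hull S).
Proof.
apply/convex_setP => x y t t0 t1 Cx Cy D [/[dup] cD /convex_setP cD' SD].
by apply: cD' => //; [apply: Cx|apply: Cy].
Qed.

Lemma sub_convex_hull (S : set V) : S `<=` convex_hull S.
Proof. exact: sub_gen_smallest. Qed.

Lemma convex_hull_sub (S C : set V) :
  @convex_set R V C -> S `<=` C -> convex_hull S `<=` C.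
Proof. by move=> cC SC; apply: smallest_sub. Qed.

Lemma convex_hull_id C : @convex_set R V C -> convex_hull C = C.
Proof.
by move=> cC; apply/seteqP; split; [apply: convex_hull_sub|apply: sub_convex_hull].
Qed.

End Convexity.

(** * Convergence in the Hausdorff distance *)

Section Hausdorff.
Context {R : realType} {V : pseudoMetricType R}.

Lemma closed_ball_approx (C : set V) x : closed C ->
  (forall e : R, 0 < e -> exists2 y, C y & ball x e y) -> C x.
Proof.
move=> cC H; apply: cC => B /nbhs_ballP [e /= e0 eB].
by have [y Cy xy] := H e e0; exists y; split=> //; apply: eB.
Qed.

(** The distance is an infimum of admissible radii, hence small exactly when some small radius is
    admissible. Being extended real, it must also be shown eventually finite. *)
Lemma cvg_hausdorff (X : nat -> set V) (M : set V) :
  hausdorff_dist (X T) M @[T --> \oo] --> 0%E <->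
  (forall e : R, 0 < e -> \forall T \near \oo,
    X T `<=` \bigcup_(y in M) ball y e /\ M `<=` \bigcup_(x in X T) ball x e).
Proof.
have dge0 T : (0 <= hausdorff_dist (X T) M)%E.
  by apply: le_ereal_inf_tmp => _ [e [e0 _ _] <-]; rewrite lee_fin ltW.
split=> [XM e e0|H].
  have: \forall T \near \oo, (hausdorff_dist (X T) M < e%:E)%E.
    suff: nbhs (0%E : \bar R) [set x | (x < e%:E)%E] by move/XM.
    by apply: open_nbhs_nbhs; split; [exact: open_ereal_lt_ereal|rewrite /= lte_fin].
  apply: filterS => T /ereal_inf_lt [_ [d [d0 XM1 XM2] <-]].
  rewrite lte_fin => de.
  split=> x => [/XM1|/XM2] [y Yy yx]; exists y => //; exact: le_ball (ltW de) _ yx.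
have dle e T : 0 < e -> X T `<=` \bigcup_(y in M) ball y e /\
    M `<=` \bigcup_(x in X T) ball x e -> (hausdorff_dist (X T) M <= e%:E)%E.
  by move=> e0 [XM MX]; apply: ereal_inf_lbound; exists e.
apply/fine_cvgP; split.
  apply: filterS (H 1 ltr01) => T /(dle _ _ ltr01) le1.
  by rewrite ge0_fin_numE// (le_lt_trans le1)// ltry.
apply/cvgr0Pnorm_le => e e0; apply: filterS (H e e0) => T /(dle _ _ e0) le1 /=.
have fin : hausdorff_dist (X T) M \is a fin_num.
  by rewrite ge0_fin_numE// (le_lt_trans le1)// ltry.
by rewrite ger0_norm ?fine_ge0// -lee_fin fineK.
Qed.

End Hausdorff.

Lemma continuous_sum (R : realType) (T : topologicalType) (I : Type)
    (s : seq I) (f : I -> T -> R) : (forall i, continuous (f i)) ->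
  continuous (fun x => \sum_(i <- s) f i x).
Proof.
move=> cf; elim: s => [|i s IH] x.
  by under eq_fun do rewrite big_nil; exact: cvg_cst.
under eq_fun do rewrite big_cons; apply: cvgD; [exact: cf|exact: IH].
Qed.

(** * Linearity of payoffs and compactness of the set of profiles *)

Section Profiles.
Context {R : realType} {m n : nat}.
Implicit Types (u : 'I_m -> 'I_n -> R) (phi : 'M[R]_(m, n)).

Lemma payoffD u phi psi : payoff u (phi + psi) = payoff u phi + payoff u psi.
Proof.
rewrite /payoff -big_split; apply: eq_bigr => i _; rewrite -big_split.
by apply: eq_bigr => j _; rewrite mxE mulrDl.
Qed.

Lemma payoffZ u (c : R) phi : payoff u (c *: phi) = c * payoff u phi.
Proof.
rewrite /payoff mulr_sumr; apply: eq_bigr => i _; rewrite mulr_sumr.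
by apply: eq_bigr => j _; rewrite mxE mulrA.
Qed.

Lemma payoff_sum u (I : Type) (s : seq I) (f : I -> 'M[R]_(m, n)) :
  payoff u (\sum_(i <- s) f i) = \sum_(i <- s) payoff u (f i).
Proof.
elim: s => [|i s IH]; last by rewrite !big_cons payoffD IH.
by rewrite !big_nil /payoff big1// => i _; rewrite big1// => j _; rewrite mxE mul0r.
Qed.

Lemma payoff_combine u v (t : R) phi :
  payoff (fun i j => u i j + t * v i j) phi = payoff u phi + t * payoff v phi.
Proof.
rewrite /payoff mulr_sumr -big_split; apply: eq_bigr => i _.
rewrite mulr_sumr -big_split; apply: eq_bigr => j _ /=; ring.
Qed.

Lemma payoff_scale u (c : R) phi :
  payoff (fun i j => c * u i j) phi = c * payoff u phi.
Proof.
rewrite /payoff mulr_sumr; apply: eq_bigr => i _; rewrite mulr_sumr.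
by apply: eq_bigr => j _ /=; ring.
Qed.

Lemma payoff_continuous u : continuous (payoff u).
Proof.
apply: continuous_sum => i; apply: continuous_sum => j phi.
apply: (@cvgM _ _ (nbhs phi) _ (fun M : 'M[R]_(m, n) => M i j) (fun=> u i j)).
  exact: coord_continuous.
exact: cvg_cst.
Qed.

(** Balls of matrices are entrywise, so the Lipschitz constant is the sum of the absolute
    payoffs. *)
Lemma payoff_lipschitz u phi psi (e : R) : ball phi e psi ->
  payoff u phi <= payoff u psi + e * \sum_i \sum_j `|u i j|.
Proof.
move=> [e0 H]; rewrite -lerBlDl /payoff mulr_sumr -sumrB; apply: ler_sum => i _.
rewrite mulr_sumr -sumrB; apply: ler_sum => j _; rewrite -mulrBl.
apply: le_trans (ler_norm _) _; rewrite normrM ler_wpM2r//.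
exact: ltW (H i j).
Qed.

Lemma csp_payoff_le u (c : R) phi :
  csp phi -> (forall i j, u i j <= c) -> payoff u phi <= c.
Proof.
move=> [p0 p1] uc; rewrite -[leRHS]mul1r -p1 mulr_suml; apply: ler_sum => i _.
by rewrite mulr_suml; apply: ler_sum => j _; rewrite ler_wpM2l.
Qed.

Lemma csp_payoff_ge u (c : R) phi :
  csp phi -> (forall i j, c <= u i j) -> c <= payoff u phi.
Proof.
move=> [p0 p1] uc; rewrite -[leLHS]mul1r -p1 mulr_suml; apply: ler_sum => i _.
by rewrite mulr_suml; apply: ler_sum => j _; rewrite ler_wpM2l.
Qed.

Lemma csp_mass phi : \sum_i \sum_j phi i j = payoff (fun _ _ => 1) phi.
Proof.
by apply: eq_bigr => i _; apply: eq_bigr => j _; rewrite mulr1.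
Qed.

Lemma csp_convex : @convex_set R 'M[R]_(m, n) (@csp R m n).
Proof.
apply/convex_setP => phi psi t t0 t1 [p0 p1] [q0 q1]; split=> [i j|].
  by rewrite !mxE addr_ge0// mulr_ge0// subr_ge0.
by rewrite csp_mass payoffD !payoffZ -!csp_mass p1 q1 !mulr1 subrKC.
Qed.

Lemma payoff_le_closed u (c : R) : closed [set phi | payoff u phi <= c].
Proof.
apply: (@preimage_closed _ _ (payoff u) [set x | x <= c]).
  by move=> phi _; exact: payoff_continuous.
exact: closed_le.
Qed.

Lemma csp_closed : closed (@csp R m n).
Proof.
have -> : @csp R m n = \bigcap_(i in [set: 'I_m * 'I_n])
    [set phi : 'M[R]_(m, n) | 0 <= phi i.1 i.2] `&`
    [set phi | payoff (fun _ _ => 1) phi = 1].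
  apply/seteqP; split=> phi [p0 p1]; split=> //=.
  - by move=> i _; exact: p0.
  - by rewrite -csp_mass.
  - by move=> i j; exact: p0 (i, j) I.
  - by rewrite csp_mass.
apply: closedI.
  apply: closed_bigI => i _.
  apply: (@preimage_closed _ _ (fun phi : 'M[R]_(m, n) => phi i.1 i.2)
    [set x | 0 <= x]).
    by move=> phi _; exact: coord_continuous.
  exact: closed_ge.
apply: (@preimage_closed _ _ (payoff (fun _ _ => 1)) [set x | x = 1]).
  by move=> phi _; exact: payoff_continuous.
exact: closed_eq.
Qed.

(** A closed subset of the image under [vec_mx] of the cube of row vectors with entries in
    [0, 1]. *)
Lemma csp_compact : compact (@csp R m n).
Proof.
have cK : compact
    [set v : 'rV[R]_(m * n) | forall k, v ord0 k \in `[0, 1]%R].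
  refine (@rV_compact R _ (fun=> `[0, 1]%classic) _).
  by move=> _; exact: segment_compact.
have cvec : continuous (vec_mx : 'rV[R]_(m * n) -> 'M[R]_(m, n)).
  move=> v B /nbhs_ballP [e /= e0 eB]; apply/nbhs_ballP; exists e => //.
  move=> w [_ vw]; apply: eB; split=> // i j; rewrite !mxE; exact: vw.
have cI := continuous_compact (continuous_subspaceT cvec) cK.
apply: (subclosed_compact csp_closed cI).
move=> phi [p0 p1]; exists (mxvec phi); last by rewrite mxvecK.
move=> k; case/mxvec_indexP: k => i j; rewrite mxvecE /= in_itv /= p0 /= -p1.
rewrite (bigD1 i)//= (bigD1 j)//= -addrA lerDl addr_ge0//.
  by apply: sumr_ge0.
by apply: sumr_ge0 => k _; apply: sumr_ge0 => l _; exact: p0.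
Qed.

Lemma maximizers_nonempty u (M : set 'M[R]_(m, n)) :
  M !=set0 -> closed M -> M `<=` @csp R m n -> maximizers u M !=set0.
Proof.
move=> M0 cM Mcsp; have cptM := subclosed_compact cM csp_compact Mcsp.
have [phi /set_mem Mphi max] :=
  compact_EVT_max M0 cptM (continuous_subspaceT (@payoff_continuous u)).
by exists phi; split=> // psi /mem_set /max.
Qed.

Lemma prod_dist_csp x y :
  simplex x -> simplex y -> csp (prod_dist x y : 'M[R]_(m, n)).
Proof.
move=> [x0 x1] [y0 y1]; split=> [i j|]; first by rewrite mxE mulr_ge0.
rewrite -x1; apply: eq_bigr => i _.
under eq_bigr do rewrite mxE.
by rewrite -mulr_sumr y1 mulr1.
Qed.

Lemma simplex_le1 k (x : 'rV[R]_k) i : simplex x -> x ord0 i <= 1.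
Proof.
by move=> [x0 <-]; rewrite (bigD1 i)//= lerDl sumr_ge0.
Qed.

Lemma simplex_delta k (i : 'I_k) : simplex (delta_mx ord0 i : 'rV[R]_k).
Proof.
split=> [j|]; first by rewrite mxE ler0n.
rewrite (bigD1 i)//= mxE !eqxx big1 ?addr0// => j ji.
by rewrite mxE (negbTE ji) andbF.
Qed.

Lemma simplex_convex k (x y : 'rV[R]_k) (t : R) : 0 <= t -> t <= 1 ->
  simplex x -> simplex y -> simplex (t *: x + (1 - t) *: y).
Proof.
move=> t0 t1 [x0 x1] [y0 y1]; split=> [i|].
  by rewrite !mxE addr_ge0// mulr_ge0// subr_ge0.
under eq_bigr do rewrite !mxE.
by rewrite big_split /= -!mulr_sumr x1 y1 !mulr1 subrKC.
Qed.

End Profiles.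

(** * Swap regret as a linear functional *)

Section Regret.
Context {R : realType} {m n : nat}.
Implicit Types (u : 'I_m -> 'I_n -> R) (phi : 'M[R]_(m, n)).

(** The gain from playing [k] whenever [j] was recommended, encoded as a payoff so that it can also
    serve as an optimizer's objective. *)
Definition regret_payoff u (j k : 'I_n) : 'I_m -> 'I_n -> R :=
  fun i l => if l == j then u i k - u i j else 0.

Lemma payoff_regret u j k phi :
  payoff (regret_payoff u j k) phi = \sum_i phi i j * (u i k - u i j).
Proof.
apply: eq_bigr => i _; rewrite (bigD1 j)//= /regret_payoff eqxx.
by rewrite big1 ?addr0// => l /negbTE ->; rewrite mulr0.
Qed.

Lemma no_swap_regretP u phi : no_swap_regret u phi <->
  csp phi /\ forall j k, payoff (regret_payoff u j k) phi <= 0.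
Proof.
have E j k : (payoff (regret_payoff u j k) phi <= 0) =
    (\sum_i phi i j * u i k <= \sum_i phi i j * u i j).
  rewrite payoff_regret -[RHS]subr_le0 -sumrB; congr (_ <= 0).
  by apply: eq_bigr => i _; rewrite mulrBr.
by split=> -[cphi H]; split=> // j k; have := H j k; rewrite E.
Qed.

Lemma payoff_regret_prod u j k (x : 'rV[R]_m) (y : 'rV[R]_n) :
  payoff (regret_payoff u j k) (prod_dist x y) =
  y ord0 j * (payoff_vs_action u x k - payoff_vs_action u x j).
Proof.
rewrite payoff_regret /payoff_vs_action -sumrB mulr_sumr; apply: eq_bigr => i _.
rewrite mxE; ring.
Qed.

Lemma payoff_vs_action_bound u (x : 'rV[R]_m) j :
  is_payoff u -> simplex x -> `|payoff_vs_action u x j| <= 1.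
Proof.
move=> uP [x0 x1]; rewrite (le_trans (ler_norm_sum _ _ _))// -x1.
apply: ler_sum => i _; rewrite normrM ger0_norm// ler_piMr//.
by rewrite ler_norml.
Qed.

Lemma no_swap_regret_convex u :
  @convex_set R 'M[R]_(m, n) (no_swap_regret u).
Proof.
apply/convex_setP => phi psi t t0 t1 /no_swap_regretP [p1 p2].
move=> /no_swap_regretP [q1 q2]; apply/no_swap_regretP; split.
  by have /convex_setP := @csp_convex R m n; apply.
move=> j k; rewrite payoffD !payoffZ -[leRHS]addr0.
by rewrite lerD// mulr_ge0_le0// subr_ge0.
Qed.

Lemma no_swap_regret_closed u : closed (no_swap_regret u).
Proof.
have -> : no_swap_regret u = @csp R m n `&` \bigcap_(i in [set: 'I_n * 'I_n])
    [set phi | payoff (regret_payoff u i.1 i.2) phi <= 0].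
  apply/seteqP; split=> phi.
    by move=> /no_swap_regretP [p1 p2]; split=> // i _; exact: p2.
  by move=> [p1 p2]; apply/no_swap_regretP; split=> // j k; exact: p2 (j, k) I.
apply: closedI; first exact: csp_closed.
by apply: closed_bigI => i _; exact: payoff_le_closed.
Qed.

Lemma nsr_menuE u : nsr_menu u = no_swap_regret u.
Proof. exact/convex_hull_id/no_swap_regret_convex. Qed.

End Regret.

(** * Regret matching and its potential *)

Section RegretMatching.
Context {R : realType}.

(* A null left vector [v] of the generator [W - diag(row sums)] exists because
   that matrix kills the constant vector; [|v|] is then invariant as well, since
   the triangle inequality is an inequality in each coordinate and an equality
   in total. *)
Lemma stationary_distribution n (W : 'M[R]_n) :
  (0 < n)%N -> (forall j k, 0 <= W j k) ->
  exists2 y : 'rV[R]_n, simplex y &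
    forall k, \sum_j y ord0 j * W j k = y ord0 k * \sum_j W k j.
Proof.
case: n W => // n W _ W0.
pose d k := \sum_j W k j.
pose Q := W - diag_mx (\row_k d k).
have [v v0 vQ] : exists2 v : 'rV[R]_n.+1, v != 0 & v *m Q = 0.
  apply/det0P; rewrite -det_tr; apply/det0P; exists (const_mx 1).
    by apply/eqP => /rowP /(_ ord0); rewrite !mxE => /eqP; rewrite oner_eq0.
  apply/rowP => k; rewrite !mxE.
  under eq_bigr do rewrite !mxE mul1r.
  rewrite sumrB -/(d k) (bigD1 k)//= eqxx mulr1n big1 ?addr0 ?subrr// => j jk.
  by rewrite eq_sym (negbTE jk) mulr0n.
have vE k : \sum_j v ord0 j * W j k = v ord0 k * d k.
  have := congr1 (fun w : 'rV_n.+1 => w ord0 k) vQ.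
  rewrite mulmxBr mul_mx_diag !mxE => /eqP; rewrite subr_eq0 => /eqP ->.
  by [].
have d0 k : 0 <= d k by apply: sumr_ge0.
have le k : `|v ord0 k| * d k <= \sum_j `|v ord0 j| * W j k.
  rewrite -(ger0_norm (d0 k)) -normrM -vE (le_trans (ler_norm_sum _ _ _))//.
  by apply: ler_sum => j _; rewrite normrM (ger0_norm (W0 _ _)).
have tot : \sum_k (\sum_j `|v ord0 j| * W j k - `|v ord0 k| * d k) = 0.
  rewrite sumrB exchange_big /= -sumrB big1// => j _.
  by rewrite -mulr_sumr subrr.
pose N := \sum_j `|v ord0 j|.
have N0 : 0 < N.
  rewrite lt_neqAle sumr_ge0// andbT eq_sym; apply/negP => /eqP/psumr_eq0P H.
  by case/eqP: v0; apply/rowP => k; rewrite mxE; apply: normr0_eq0; exact: H.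
exists (\row_k (`|v ord0 k| / N)).
  split=> [k|]; first by rewrite mxE divr_ge0// ltW.
  under eq_bigr do rewrite mxE.
  by rewrite -mulr_suml divff// gt_eqF.
move=> k; rewrite mxE mulrAC; under eq_bigr do rewrite mxE mulrAC.
rewrite -mulr_suml; congr (_ / _); apply/eqP; rewrite -subr_eq0.
have /psumr_eq0P := tot; rewrite /d => -> // j _.
by rewrite subr_ge0 le.
Qed.

Definition stationary n (W : 'M[R]_n) : 'rV[R]_n :=
  xget 0 [set y | simplex y /\
    forall k, \sum_j y ord0 j * W j k = y ord0 k * \sum_j W k j].

Lemma stationaryP n (W : 'M[R]_n) : (0 < n)%N -> (forall j k, 0 <= W j k) ->
  simplex (stationary W) /\
  forall k, \sum_j stationary W ord0 j * W j k =
            stationary W ord0 k * \sum_j W k j.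
Proof.
move=> n0 W0; have [y y1 y2] := stationary_distribution n0 W0.
by rewrite /stationary; case: xgetP => [_ -> //|] /(_ y) [].
Qed.

Context {m n : nat} (u : 'I_m -> 'I_n -> R).

Definition regret_play (S : 'M[R]_n) : 'rV[R]_n :=
  stationary (map_mx (Num.max 0) S).

Definition regret_update (S : 'M[R]_n) (x : 'rV[R]_m) : 'M[R]_n :=
  S + \matrix_(j, k) payoff (regret_payoff u j k) (prod_dist x (regret_play S)).

Lemma regret_updateE S x j k : regret_update S x j k =
  S j k + payoff (regret_payoff u j k) (prod_dist x (regret_play S)).
Proof. by rewrite /regret_update !mxE. Qed.

(** A learner sees only the optimizer's moves; the fold recomputes its own past moves from the
    regret matrix. *)
Definition cumulative_regret : seq 'rV[R]_m -> 'M[R]_n :=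
  foldl regret_update 0.

Lemma cumulative_regret_rcons s x :
  cumulative_regret (rcons s x) = regret_update (cumulative_regret s) x.
Proof. exact: foldl_rcons. Qed.

Definition regret_matching (T : nat) (s : seq 'rV[R]_m) : 'rV[R]_n :=
  regret_play (cumulative_regret s).

(** The squared Euclidean distance from [S] to the nonpositive orthant, as in Blackwell
    approachability. *)
Definition potential (S : 'M[R]_n) : R :=
  \sum_j \sum_k Num.max 0 (S j k) ^+ 2.

Hypothesis n_gt0 : (0 < n)%N.
Hypothesis uP : is_payoff u.

Lemma regret_playP S : simplex (regret_play S) /\
  forall k, \sum_j regret_play S ord0 j * Num.max 0 (S j k) =
            regret_play S ord0 k * \sum_j Num.max 0 (S k j).
Proof.
have W0 j k : 0 <= map_mx (Num.max 0) S j k by rewrite mxE le_max lexx.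
have [y1 y2] := stationaryP n_gt0 W0; split=> // k.
have := y2 k; under eq_bigr do rewrite mxE.
by move=> ->; congr (_ * _); apply: eq_bigr => j _; rewrite mxE.
Qed.

Lemma regret_matching_learning : learning_algorithm regret_matching.
Proof. by move=> T s _ _; have [] := regret_playP (cumulative_regret s). Qed.

(** Second-order bound for the squared positive part, whose derivative [2 * Num.max 0 a] is
    2-Lipschitz. *)
Lemma sqr_maxD (a b : R) :
  Num.max 0 (a + b) ^+ 2 <= Num.max 0 a ^+ 2 + 2 * (Num.max 0 a * b) + b ^+ 2.
Proof.
by rewrite /Num.max; case: ifP => h1; case: ifP => h2; nra.
Qed.

(* Stationarity of the play makes the first-order term of the potential
   vanish. *)
Lemma potential_update S x : simplex x ->
  potential (regret_update S x) <= potential S + 4 * n%:R ^+ 2.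
Proof.
move=> xs; have [[y0 y1] yP] := regret_playP S.
pose y := regret_play S; pose c := payoff_vs_action u x.
pose P j k := Num.max 0 (S j k); pose b j k := y ord0 j * (c k - c j).
have cross : \sum_j \sum_k P j k * b j k = 0.
  (* Inflow into [k] weighted by [c k], minus outflow from [j] weighted by [c j]; stationarity
     equates the two action by action. *)
  have -> : \sum_j \sum_k P j k * b j k =
      \sum_k c k * \sum_j y ord0 j * P j k -
      \sum_j c j * (y ord0 j * \sum_k P j k).
    transitivity (\sum_j \sum_k (c k * (y ord0 j * P j k)) -
                  \sum_j \sum_k (c j * (y ord0 j * P j k))).
      rewrite -sumrB; apply: eq_bigr => j _; rewrite -sumrB.
      by apply: eq_bigr => k _; rewrite /b; ring.
    congr (_ - _); last first.
      by apply: eq_bigr => j _; rewrite !mulr_sumr.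
    by rewrite exchange_big; apply: eq_bigr => k _; rewrite mulr_sumr.
  by apply/eqP; rewrite subr_eq0; apply/eqP/eq_bigr => k _; rewrite yP.
(* Two payoffs in [-1, 1] differ by at most 2, and the weight [y ord0 j] is at most 1. *)
have b2 j k : b j k ^+ 2 <= 4.
  have yj : y ord0 j <= 1 by apply: simplex_le1.
  have yj0 : 0 <= y ord0 j by apply: y0.
  have ck := payoff_vs_action_bound k uP xs.
  have cj := payoff_vs_action_bound j uP xs.
  rewrite -[leRHS]/(4%:R) (_ : 4%:R = 2 ^+ 2 :> R); last by rewrite -natrX.
  rewrite -ler_sqrt ?exprn_ge0//.
  rewrite !sqrtr_sqr [leRHS]ger0_norm// normrM ger0_norm//.
  rewrite -[leRHS]mul1r ler_pM// (le_trans (ler_normB _ _))//.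
  by rewrite (_ : 2 = 1 + 1)// lerD.
apply: (@le_trans _ _ (\sum_j \sum_k (P j k ^+ 2 + 2 * (P j k * b j k) + 4))).
  apply: ler_sum => j _; apply: ler_sum => k _.
  rewrite regret_updateE payoff_regret_prod (le_trans (sqr_maxD _ _))// lerD2l.
  exact: b2.
under eq_bigr do rewrite !big_split /= -mulr_sumr.
rewrite !big_split /= -mulr_sumr cross mulr0 addr0 /potential lerD2l.
by rewrite !sumr_const !card_ord -[_ *+ n]mulr_natr; lra.
Qed.

Lemma potential_cumulative s : (forall x, x \in s -> simplex x) ->
  potential (cumulative_regret s) <= (size s)%:R * (4 * n%:R ^+ 2).
Proof.
elim/last_ind: s => [_|s x IH H].
  rewrite mul0r /potential big1// => j _; rewrite big1// => k _.
  by rewrite mxE maxxx expr0n.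
rewrite size_rcons -natr1 mulrDl mul1r cumulative_regret_rcons.
rewrite (le_trans (potential_update _ _))//.
  by apply: H; rewrite mem_rcons mem_head.
rewrite lerD2r; apply: IH => z zs; apply: H.
by rewrite mem_rcons inE zs orbT.
Qed.

(** The moves recomputed by the fold are those the algorithm makes on the prefixes [take t x], and
    payoffs are linear. *)
Lemma cumulative_regret_average T (x : T.-tuple 'rV[R]_m) j k : (0 < T)%N ->
  cumulative_regret x j k =
  T%:R * payoff (regret_payoff u j k) (average_play regret_matching x).
Proof.
move=> T0; rewrite payoffZ mulVKf ?pnatr_eq0 -?lt0n// payoff_sum.
pose f i := payoff (regret_payoff u j k)
  (prod_dist (nth 0 x i) (regret_matching T (take i x))).
have H t : (t <= T)%N ->
    cumulative_regret (take t x) j k = \sum_(0 <= i < t) f i.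
  elim: t => [_|t IH tT]; first by rewrite take0 big_geq// mxE.
  rewrite (take_nth 0) ?size_tuple// cumulative_regret_rcons regret_updateE.
  rewrite (IH (ltnW tT)) (big_nat_recr t 0 f (leq0n t)); exact: erefl.
have := H T (leqnn T); rewrite take_oversize ?size_tuple// => ->.
by rewrite big_mkord; apply: eq_bigr => i _; rewrite /f (tnth_nth 0).
Qed.

(** A single average regret above [e] would push the potential above [(T * e) ^ 2], whereas it is at
    most [4 * n ^ 2 * T]. *)
Lemma regret_matching_average T (x : T.-tuple 'rV[R]_m) (e : R) j k :
  (0 < T)%N -> 0 < e -> 4 * n%:R ^+ 2 <= T%:R * e ^+ 2 ->
  (forall t, simplex (tnth x t)) ->
  payoff (regret_payoff u j k) (average_play regret_matching x) <= e.
Proof.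
move=> T0 e0 eT xs; set r := payoff _ _; rewrite leNgt; apply/negP => er.
have T0' : 0 < T%:R :> R by rewrite ltr0n.
have /potential_cumulative : forall z, z \in tval x -> simplex z.
  by move=> z /tnthP [t ->].
rewrite size_tuple leNgt => /negP; apply.
apply: (@lt_le_trans _ _ ((T%:R * r) ^+ 2)).
  rewrite exprMn expr2 -mulrA ltr_pM2l// (le_lt_trans eT)// ltr_pM2l//.
  by rewrite ltr_sqr ?nnegrE ?ltW// (lt_trans e0).
rewrite -cumulative_regret_average//; set S := cumulative_regret x.
have S0 : 0 <= S j k.
  by rewrite cumulative_regret_average// mulr_ge0// ltW// (lt_trans e0).
rewrite /potential (bigD1 j)//= (bigD1 k)//= -addrA.
rewrite (max_idPr S0) lerDl addr_ge0//.
  by apply: sumr_ge0 => l _; rewrite sqr_ge0.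
by apply: sumr_ge0 => l _; apply: sumr_ge0 => l' _; rewrite sqr_ge0.
Qed.

End RegretMatching.

(** * Pure best replies and the profiles they generate *)

Section BestResponses.
Context {R : realType} {m n : nat}.
Implicit Types (u : 'I_m -> 'I_n -> R) (x : 'rV[R]_m).

Lemma unique_best_responseP u x j : best_responses u x = [set j] <->
  forall k, k != j -> payoff_vs_action u x k < payoff_vs_action u x j.
Proof.
split=> [E k kj|H].
  have jB : best_responses u x j by rewrite E.
  rewrite lt_neqAle jB andbT; apply: contra_neq kj => kE.
  suff : best_responses u x k by rewrite E.
  by move=> l; rewrite kE.
apply/seteqP; split=> k /=.
  move=> kB; apply/eqP; apply: contraT => /H; rewrite ltNge => /negP; case.
  exact: kB.
by move=> -> l; have [->//|/H/ltW] := eqVneq l j.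
Qed.

Lemma payoff_vs_actionD u (t : R) x x' j :
  payoff_vs_action u (t *: x + (1 - t) *: x') j =
  t * payoff_vs_action u x j + (1 - t) * payoff_vs_action u x' j.
Proof.
rewrite /payoff_vs_action !mulr_sumr -big_split; apply: eq_bigr => i _ /=.
rewrite !mxE; ring.
Qed.

Definition pure_reply x (j : 'I_n) : 'M[R]_(m, n) :=
  prod_dist x (delta_mx ord0 j).

Lemma pure_replyE x j i k : pure_reply x j i k = x ord0 i * (k == j)%:R.
Proof. by rewrite !mxE eqxx. Qed.

(** The regret for not switching from [k] to [j] is [y ord0 k] times a positive gap, so low regret
    forces little mass off [j]. *)
Lemma low_regret_pure_reply u x j (e : R) :
  simplex x -> best_responses u x = [set j] -> 0 < e ->
  exists2 d : R, 0 < d & forall y, simplex y ->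
    (forall k l, payoff (regret_payoff u k l) (prod_dist x y) <= d) ->
    ball (pure_reply x j) e (prod_dist x y).
Proof.
move=> xs /unique_best_responseP gap e0.
pose g k := payoff_vs_action u x j - payoff_vs_action u x k.
pose G := \sum_(k | k != j) (g k)^-1.
have g0 k : k != j -> 0 < g k by move=> /gap; rewrite subr_gt0.
have G0 : 0 <= G by apply: sumr_ge0 => k /g0/ltW; rewrite invr_ge0.
(* The mass off [j] is then at most [e * G / (1 + G) < e]; the summand 1 keeps the denominator
   positive when [j] is the only action. *)
exists (e / (1 + G)); first by rewrite divr_gt0// ltr_pwDl.
move=> y ys H.
have ye k : k != j -> y ord0 k <= e / (1 + G) * (g k)^-1.
  move=> kj; rewrite ler_pdivlMr ?g0//.
  by have := H k j; rewrite payoff_regret_prod.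
have rest : \sum_(k | k != j) y ord0 k < e.
  rewrite (le_lt_trans (ler_sum _ ye))// -mulr_sumr -/G.
  by rewrite mulrAC ltr_pdivrMr ?ltr_pwDl// ltr_pM2l// ltrDr.
have [y0 y1] := ys; have [x0 x1] := xs.
split=> // i k; rewrite pure_replyE mxE /ball /= -mulrBr normrM.
rewrite (ger0_norm (x0 _)) (le_lt_trans (ler_piMl _ (simplex_le1 i xs)))//.
have [->|kj] := eqVneq k j.
  rewrite -y1 (bigD1 j)//= addrAC subrr add0r ger0_norm//.
  exact: sumr_ge0.
rewrite sub0r normrN ger0_norm// (le_lt_trans _ rest)//.
by rewrite (bigD1 k)//= lerDl sumr_ge0.
Qed.

(** * Closed convex sets containing all strict best replies *)

Section Minimality.
Variable u : 'I_m -> 'I_n -> R.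
Hypothesis u_dom : no_weakly_dominated_action u.
Variable C : set 'M[R]_(m, n).
Hypotheses (C_closed : closed C) (C_convex : @convex_set R 'M[R]_(m, n) C).
Hypothesis C_strict : forall x j, simplex x -> best_responses u x = [set j] ->
  C (pure_reply x j).

(** Mixing into [x] a little of a strategy whose only best response is [j] makes [j] strictly best;
    closedness lets the mixing weight tend to 0. *)
Lemma best_reply_closed_convex x j :
  simplex x -> best_responses u x j -> C (pure_reply x j).
Proof.
move=> xs xj; have [|x' x's x'j] := @u_dom j; first by exists x.
apply: closed_ball_approx => // e e0.
(* Entries move by at most [t]; the cap 1 makes [t] a legitimate mixing weight. *)
pose t := Num.min 1 (e / 2).
have t0 : 0 < t by rewrite lt_min ltr01 divr_gt0.
have t1 : t <= 1 by rewrite ge_min lexx.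
exists (pure_reply (t *: x' + (1 - t) *: x) j).
  apply: C_strict; first by apply: simplex_convex => //; exact: ltW.
  apply/unique_best_responseP => k kj; rewrite !payoff_vs_actionD.
  rewrite ltr_leD//; last by rewrite ler_wpM2l ?subr_ge0.
  by rewrite ltr_pM2l//; move/unique_best_responseP: x'j; apply.
split=> // i k; rewrite !pure_replyE !mxE /ball /= -mulrBl normrM.
have le1 : `|(k == j)%:R : R| <= 1 by rewrite normr_nat lern1 leq_b1.
rewrite (le_lt_trans (ler_piMr _ le1))//.
have -> : x ord0 i - (t * x' ord0 i + (1 - t) * x ord0 i) =
          t * (x ord0 i - x' ord0 i) by ring.
have [x0 _] := xs; have [x'0 _] := x's.
have := x0 i; have := x'0 i; have := simplex_le1 i xs.
have := simplex_le1 i x's => *.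
rewrite normrM gtr0_norm// (@le_lt_trans _ _ t)//.
  by rewrite ler_piMr ?(ltW t0)// ler_norml; lra.
have : t <= e / 2 by rewrite ge_min lexx orbT.
lra.
Qed.

(** Conditioning on the column: [phi] is a mixture of pure replies [j] to the conditional strategies
    [x j], and having no swap regret says that [j] is a best response to [x j]. *)
Lemma no_swap_regret_sub_closed_convex : no_swap_regret u `<=` C.
Proof.
move=> phi /no_swap_regretP [[p0 p1] pr].
pose l j := \sum_i phi i j.
(* For a column of mass 0 this is the zero vector, not a strategy, but its weight in the mixture is
   0. *)
pose x j : 'rV[R]_m := \row_i ((l j)^-1 * phi i j).
have l0 j : 0 <= l j by apply: sumr_ge0.
have phiE : phi = \sum_j l j *: pure_reply (x j) j.
  apply/matrixP => i k; rewrite summxE (bigD1 k)//= big1 => [|j jk].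
    rewrite addr0 mxE pure_replyE mxE eqxx mulr1.
    have [l0'|ln0] := eqVneq (l k) 0; last by rewrite mulVKf.
    by rewrite l0' mul0r; move/psumr_eq0P: l0' => ->.
  by rewrite mxE pure_replyE eq_sym (negbTE jk) !mulr0.
rewrite phiE; apply: convex_set_sum => //.
  by rewrite -p1 exchange_big.
move=> j lj; apply: best_reply_closed_convex.
  split=> [i|]; first by rewrite mxE mulr_ge0// invr_ge0.
  by under eq_bigr do rewrite mxE; rewrite -mulr_sumr mulVf// gt_eqF.
move=> k; have := pr j k; rewrite payoff_regret.
under eq_bigr do rewrite mulrBr; rewrite sumrB subr_le0.
have E l' : payoff_vs_action u (x j) l' = (l j)^-1 * \sum_i phi i j * u i l'.
  by rewrite mulr_sumr; apply: eq_bigr => i _; rewrite mxE mulrA.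
by rewrite !E ler_pM2l ?invr_gt0.
Qed.

End Minimality.
End BestResponses.

(** * Finite-horizon menus and convergence of the regret-matching menus *)

Section Menus.
Context {R : realType} {m n : nat}.
Implicit Types (u : 'I_m -> 'I_n -> R) (A : nat -> seq 'rV[R]_m -> 'rV[R]_n).

Lemma ball_convex (phi phi' psi psi' : 'M[R]_(m, n)) (e t : R) :
  0 <= t -> t <= 1 -> ball phi e psi -> ball phi' e psi' ->
  ball (t *: phi + (1 - t) *: phi') e (t *: psi + (1 - t) *: psi').
Proof.
move=> t0 t1 [e0 H] [_ H']; split=> // i j.
have := H i j; have := H' i j; rewrite /ball /= !mxE !ltr_norml.
move=> /andP[a1 a2] /andP[b1 b2].
have -> : t * phi i j + (1 - t) * phi' i j -
    (t * psi i j + (1 - t) * psi' i j) =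
  t * (phi i j - psi i j) + (1 - t) * (phi' i j - psi' i j) by ring.
have [->|tn0] := eqVneq t 0; first by rewrite subr0 !mul0r !add0r !mul1r a1 a2.
have t0' : 0 < t by rewrite lt_neqAle eq_sym tn0.
by apply/andP; split; nra.
Qed.

Lemma menu_convex A T : @convex_set R 'M[R]_(m, n) (menu A T).
Proof. exact: convex_hull_convex. Qed.

Lemma average_play_menu A T (x : T.-tuple 'rV[R]_m) :
  (forall t, simplex (tnth x t)) -> menu A T (average_play A x).
Proof. by move=> xs; apply: sub_convex_hull; exists x. Qed.

Lemma learning_simplex A T (x : T.-tuple 'rV[R]_m) (t : 'I_T) :
  learning_algorithm A -> (forall t, simplex (tnth x t)) ->
  simplex (A T (take t x)).
Proof.
move=> LA xs; apply: LA; first by rewrite size_take size_tuple ltn_ord.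
by move=> z /mem_take /tnthP [s ->].
Qed.

Lemma average_play_csp A T (x : T.-tuple 'rV[R]_m) :
  (0 < T)%N -> learning_algorithm A -> (forall t, simplex (tnth x t)) ->
  csp (average_play A x).
Proof.
move=> T0 LA xs; rewrite /average_play scaler_sumr.
apply: convex_set_sum; first exact: csp_convex.
- by move=> _; rewrite invr_ge0.
- by rewrite sumr_const card_ord -[LHS]mulr_natr mulVf// pnatr_eq0 -lt0n.
by move=> t _; apply: prod_dist_csp => //; exact: learning_simplex.
Qed.

Lemma menu_csp A T : (0 < T)%N -> learning_algorithm A ->
  menu A T `<=` @csp R m n.
Proof.
move=> T0 LA; apply: convex_hull_sub; first exact: csp_convex.
by move=> _ [x xs <-]; exact: average_play_csp.
Qed.

(** The constant factor [x] comes out of the average, so [y] is the time average of the learner's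
    moves. *)
Lemma average_play_const A T (x : 'rV[R]_m) :
  (0 < T)%N -> learning_algorithm A -> simplex x ->
  exists2 y, simplex y & average_play A (nseq_tuple T x) = prod_dist x y.
Proof.
move=> T0 LA xs; have xs' t : simplex (tnth (nseq_tuple T x) t).
  by rewrite tnth_nseq.
pose y t := A T (take t (nseq_tuple T x)).
have ys (t : 'I_T) : simplex (y t) by exact: learning_simplex.
exists (T%:R^-1 *: \sum_(t < T) y t).
  split=> [j|].
    rewrite mxE summxE mulr_ge0 ?invr_ge0// sumr_ge0// => t _.
    by have [] := ys t.
  under eq_bigr do rewrite mxE summxE.
  rewrite -mulr_sumr exchange_big /= (eq_bigr (fun=> 1)) => [|t _].
    by rewrite sumr_const card_ord mulVf// pnatr_eq0 -lt0n.
  by have [] := ys t.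
apply/matrixP => i j; rewrite !mxE !summxE [RHS]mulrCA.
congr (_ * _); rewrite mulr_sumr; apply: eq_bigr => t _.
by rewrite mxE tnth_nseq.
Qed.

(** By compactness it suffices to treat a neighbourhood of each [phi]: either [phi] itself is the
    nearby point, or it has a regret [r > 0], and regrets above [r / 2] around it rule out every
    [d < r / 2]. *)
Lemma near_no_swap_regret u (e : R) : 0 < e -> exists2 d : R, 0 < d &
  forall phi, csp phi -> (forall j k, payoff (regret_payoff u j k) phi <= d) ->
    exists2 psi, no_swap_regret u psi & ball psi e phi.
Proof.
move=> e0; pose P (d : R) (phi : 'M[R]_(m, n)) := csp phi ->
  (forall j k, payoff (regret_payoff u j k) phi <= d) ->
  exists2 psi, no_swap_regret u psi & ball psi e phi.
have : \forall d \near 0^'+, @csp R m n `<=` P d.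
  apply: (iffLR (compact_near_coveringP _) (@csp_compact R m n)) => phi phiC.
  have [phiN|/no_swap_regretP/not_andP [//|/existsNP [j /existsNP [k /negP]]]] :=
    pselect (no_swap_regret u phi).
    exists (ball phi e, setT); first by split; [exact: nbhsx_ballx|exact: filterT].
    by move=> [phi' d] [/= phiB _] _ _; exists phi.
  rewrite -ltNge; set r := payoff _ _ => r0.
  exists ([set phi' | r / 2 < payoff (regret_payoff u j k) phi'],
          [set d | d < r / 2]).
    split => /=.
      apply: (cvgr_gt _ (@payoff_continuous _ _ _ (regret_payoff u j k) phi)).
      by rewrite -/r; lra.
    by apply: nbhs_right_lt; rewrite divr_gt0.
  move=> [phi' d] [/= H1 H2] _ /(_ j k) H3.
  by have := lt_trans (le_lt_trans H3 H2) H1; rewrite ltxx.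
move=> H; near (0 : R)^'+ => d; exists d; first by near: d; exact: nbhs_right_gt.
have dP : @csp R m n `<=` P d by near: d.
by move=> phi phiC; exact: dP.
Unshelve. all: end_near. Qed.

Lemma asymptotic_nsr_menu u : (0 < n)%N -> is_payoff u ->
  no_weakly_dominated_action u -> asymptotic_menu (nsr_menu u).
Proof.
move=> n0 uP u_dom; rewrite nsr_menuE; split; first exact: no_swap_regret_closed.
have LA := regret_matching_learning u n0.
exists (regret_matching u) => //.
have large (e : R) : 0 < e -> \forall T \near \oo,
    (0 < T)%N /\ 4 * n%:R ^+ 2 <= T%:R * e ^+ 2.
  move=> e0; near=> T; split; first by near: T; exact: nbhs_infty_gt.
  rewrite -ler_pdivrMr ?exprn_gt0//; near: T; exact: nbhs_infty_ger.
apply/cvg_hausdorff => e e0.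
pose M := menu (regret_matching u).
have upper : \forall T \near \oo,
    M T `<=` \bigcup_(psi in no_swap_regret u) ball psi e.
  have [d d0 dP] := near_no_swap_regret u e0.
  apply: filterS (large d d0) => T [T0 dT] phi Mphi.
  (* Both conditions define convex sets, so they need checking only on average plays, not on the
     whole hull. *)
  suff [phiC phiR] : csp phi /\
      forall j k, payoff (regret_payoff u j k) phi <= d.
    by have [psi] := dP phi phiC phiR; exists psi.
  move: phi Mphi; apply: convex_hull_sub.
    apply/convex_setP => phi psi t t0 t1 [p1 p2] [q1 q2]; split.
      by have /convex_setP := @csp_convex R m n; apply.
    move=> j k; rewrite payoffD !payoffZ.
    have -> : d = t * d + (1 - t) * d by ring.
    by rewrite lerD// ler_wpM2l// subr_ge0.
  move=> _ [x xs <-]; split; first exact: average_play_csp.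
  by move=> j k; exact: regret_matching_average.
(* The lower limit of the menus. It is closed and convex and contains the strict best replies, hence
   every no-swap-regret profile. *)
pose L := [set phi : 'M[R]_(m, n) | forall e : R, 0 < e ->
  \forall T \near \oo, exists2 psi, M T psi & ball phi e psi].
have NL : no_swap_regret u `<=` L.
  apply: no_swap_regret_sub_closed_convex => //.
  - move=> phi phiL d d0; have d20 : 0 < d / 2 by rewrite divr_gt0.
    have [phi' [Lphi' phiphi']] := phiL _ (nbhsx_ballx phi _ d20).
    apply: filterS (Lphi' _ d20) => T [psi Mpsi phi'psi]; exists psi => //.
    by rewrite [d]splitr; exact: ball_triangle phiphi' phi'psi.
  - apply/convex_setP => phi phi' t t0 t1 Lphi Lphi' d d0.
    near=> T; have [psi Mpsi B] : exists2 psi, M T psi & ball phi d psi.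
      by near: T; exact: Lphi.
    have [psi' Mpsi' B'] : exists2 psi, M T psi & ball phi' d psi.
      by near: T; exact: Lphi'.
    exists (t *: psi + (1 - t) *: psi'); last exact: ball_convex.
    by have /convex_setP := @menu_convex (regret_matching u) T; apply.
  - move=> x j xs xj d d0.
    have [r r0 rP] := low_regret_pure_reply xs xj d0.
    apply: filterS (large r r0) => T [T0 rT].
    have xs' t : simplex (tnth (nseq_tuple T x) t) by rewrite tnth_nseq.
    have [y ys E] := average_play_const T0 LA xs.
    exists (average_play (regret_matching u) (nseq_tuple T x)).
      exact: average_play_menu.
    rewrite E; apply: rP => // k l; rewrite -E.
    exact: regret_matching_average.
have cN := subclosed_compact (@no_swap_regret_closed R m n u) (@csp_compact R m n)
  (fun phi H => (iffLR (no_swap_regretP u phi) H).1).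
(* Compactness turns the pointwise approximation into one whose horizon threshold is the same for
   all profiles. *)
have lower : \forall T \near \oo,
    no_swap_regret u `<=` [set phi | exists2 psi, M T psi & ball psi e phi].
  apply: (iffLR (compact_near_coveringP _) cN) => phi /NL Lphi.
  have e20 : 0 < e / 2 by rewrite divr_gt0.
  exists (ball phi (e / 2), [set T | exists2 psi, M T psi & ball phi (e / 2) psi]).
    by split; [exact: nbhsx_ballx|exact: Lphi].
  move=> [phi' T] [/= B [psi Mpsi B']]; exists psi => //.
  by rewrite [e]splitr; exact: ball_triangle (ball_sym B') B.
by apply: filterS2 upper lower => T H1 H2; split.
Unshelve. all: end_near. Qed.

End Menus.

(** * Properties common to all asymptotic menus *)

Section AsymptoticMenus.
Context {R : realType} {m n : nat}.
Variable M : set 'M[R]_(m, n).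
Hypothesis M_menu : asymptotic_menu M.

(** One finite-horizon menu within [e] is all that is needed to pass its properties on to the closed
    limit. *)
Lemma asymptotic_menu_approx (e : R) : 0 < e -> exists A T,
  [/\ (0 < T)%N, learning_algorithm A,
      menu A T `<=` \bigcup_(psi in M) ball psi e &
      M `<=` \bigcup_(psi in menu A T) ball psi e].
Proof.
move=> e0; have [_ [A LA /cvg_hausdorff /(_ e e0) H]] := M_menu.
near \oo => T; exists A, T.
have [H1 H2] : menu A T `<=` \bigcup_(psi in M) ball psi e /\
  M `<=` \bigcup_(psi in menu A T) ball psi e by near: T.
by split=> //; near: T; exact: nbhs_infty_gt.
Unshelve. all: end_near. Qed.

Lemma asymptotic_menu_csp : M `<=` @csp R m n.
Proof.
move=> phi Mphi; apply: closed_ball_approx; first exact: csp_closed.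
move=> e /asymptotic_menu_approx [A [T [T0 LA _ H]]].
have [psi psiM B] := H _ Mphi; exists psi; last exact: ball_sym.
exact: menu_csp psiM.
Qed.

Lemma asymptotic_menu_convex : @convex_set R 'M[R]_(m, n) M.
Proof.
apply/convex_setP => phi phi' t t0 t1 Mphi Mphi'.
apply: closed_ball_approx; first by case: M_menu.
move=> e e0; have e20 : 0 < e / 2 by rewrite divr_gt0.
have [A [T [T0 LA H1 H2]]] := asymptotic_menu_approx e20.
have [psi psiM B] := H2 _ Mphi; have [psi' psi'M B'] := H2 _ Mphi'.
have /convex_setP/(_ _ _ _ t0 t1 psiM psi'M)/H1 [chi Mchi Bchi] :=
  @menu_convex R m n A T.
exists chi => //; rewrite [e]splitr; apply: ball_triangle (ball_sym Bchi).
by apply: ball_convex => //; exact: ball_sym.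
Qed.

Lemma asymptotic_menu_reply (x : 'rV[R]_m) (e : R) : simplex x -> 0 < e ->
  exists y psi, [/\ simplex y, M psi & ball psi e (prod_dist x y)].
Proof.
move=> xs /asymptotic_menu_approx [A [T [T0 LA H _]]].
have [y ys E] := average_play_const T0 LA xs.
have xs' t : simplex (tnth (nseq_tuple T x) t) by rewrite tnth_nseq.
have [psi Mpsi B] := H _ (average_play_menu (A := A) xs').
by exists y, psi; rewrite -E.
Qed.

(** Against a constant [x], [M] has a point near some product [prod_dist x y]. That point has no
    swap regret, so the product has little, which forces [y] towards the strict best response. *)
Lemma no_swap_regret_minimal (u : 'I_m -> 'I_n -> R) :
  no_weakly_dominated_action u ->
  M `<=` no_swap_regret u -> no_swap_regret u `<=` M.
Proof.
move=> u_dom MN; have [Mcl _] := M_menu.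
apply: no_swap_regret_sub_closed_convex => //.
  exact: asymptotic_menu_convex.
move=> x j xs xj; apply: closed_ball_approx => // e e0.
have e20 : 0 < e / 2 by rewrite divr_gt0.
have [d d0 dP] := low_regret_pure_reply xs xj e20.
pose B := \sum_k \sum_l \sum_i \sum_j `|regret_payoff u k l i j|.
have S0 (p : 'I_m -> 'I_n -> R) : 0 <= \sum_i \sum_j `|p i j|.
  by apply: sumr_ge0 => i _; apply: sumr_ge0.
have B0 : 0 <= B by apply: sumr_ge0 => k _; apply: sumr_ge0.
have leB k l : \sum_i \sum_j `|regret_payoff u k l i j| <= B.
  rewrite /B (bigD1 k)//= (bigD1 l)//= -addrA lerDl addr_ge0//.
    by apply: sumr_ge0.
  by apply: sumr_ge0 => k' _; apply: sumr_ge0.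
(* The first bound serves the triangle inequality; the second keeps the transferred regret below
   [d], since [B] dominates every Lipschitz constant. *)
pose r := Num.min (e / 2) (d / (1 + B)).
have r0 : 0 < r by rewrite lt_min e20 divr_gt0// ltr_pwDl.
have [y [psi [ys Mpsi Bpsi]]] := asymptotic_menu_reply xs r0.
exists psi => //; rewrite [e]splitr.
apply: (@ball_triangle _ _ (prod_dist x y)); last first.
  by apply: ball_sym; apply: le_ball Bpsi; rewrite ge_min lexx.
apply: dP => // k l.
rewrite (le_trans (payoff_lipschitz _ (ball_sym Bpsi)))//.
have /no_swap_regretP [_ /(_ k l) psiR] := MN _ Mpsi.
have rd : r * (1 + B) <= d.
  by rewrite -ler_pdivlMr ?ltr_pwDl// ge_min lexx orbT.
have := leB k l; set s := \sum_i _ => sB.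
have : r * s <= r * B by rewrite ler_pM2l.
lra.
Qed.

End AsymptoticMenus.

(** * Domination and support functions *)

Section ParetoOptimality.
Context {R : realType} {m n : nat}.
Variable uL : 'I_m -> 'I_n -> R.
Hypothesis uL_payoff : is_payoff uL.
Implicit Types (u w : 'I_m -> 'I_n -> R) (M : set 'M[R]_(m, n)).

Lemma maximizers_scale u (c : R) M : 0 < c ->
  maximizers (fun i j => c * u i j) M = maximizers u M.
Proof.
move=> c0; apply/seteqP; split=> phi [Mphi H]; split=> // psi /H.
  by rewrite !payoff_scale ler_pM2l.
by move=> H'; rewrite !payoff_scale ler_pM2l.
Qed.

(** Positive scaling leaves the maximizers unchanged, so the comparison extends to unbounded payoffs
    such as [w + t uL]. *)
Lemma VL_le_all M M' :
  (forall u, is_payoff u -> VL uL M u <= VL uL M' u) ->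
  forall u, VL uL M u <= VL uL M' u.
Proof.
move=> H u; pose B := 1 + \sum_i \sum_j `|u i j|.
have S0 : 0 <= \sum_i \sum_j `|u i j|.
  by apply: sumr_ge0 => i _; apply: sumr_ge0.
have B0 : 0 < B by rewrite ltr_pwDl.
have Bi : 0 < B^-1 by rewrite invr_gt0.
have := H (fun i j => B^-1 * u i j); rewrite /VL !maximizers_scale//; apply.
move=> i j; rewrite -ler_norml normrM gtr0_norm// mulrC ler_pdivrMr// mul1r.
rewrite /B (bigD1 i)//= (bigD1 j)//=.
have : 0 <= \sum_(l | l != j) `|u i l| by apply: sumr_ge0.
have : 0 <= \sum_(k | k != i) \sum_l `|u k l|.
  by apply: sumr_ge0 => k _; apply: sumr_ge0.
lra.
Qed.

Lemma payoff_le_VL u M phi : M `<=` @csp R m n ->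
  maximizers u M phi -> payoff uL phi <= VL uL M u.
Proof.
move=> MC Hphi; apply: ub_le_sup; last by exists phi.
exists 1 => _ [psi [/MC psiC _] <-]; apply: csp_payoff_le => // i j.
by have /andP[] := uL_payoff i j.
Qed.

Lemma VL_le u M (c : R) : maximizers u M !=set0 ->
  (forall phi, maximizers u M phi -> payoff uL phi <= c) -> VL uL M u <= c.
Proof.
move=> [phi Hphi] H; apply: ge_sup; first by exists (payoff uL phi), phi.
by move=> _ [psi Hpsi <-]; exact: H.
Qed.

Lemma VL_bounds u M : M !=set0 -> closed M -> M `<=` @csp R m n ->
  -1 <= VL uL M u <= 1.
Proof.
move=> M0 Mcl MC; have [phi Hphi] := maximizers_nonempty u M0 Mcl MC.
apply/andP; split.
  rewrite (le_trans _ (payoff_le_VL MC Hphi))//.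
  apply: csp_payoff_ge; first exact/MC/(proj1 Hphi).
  by move=> i j; have /andP[] := uL_payoff i j.
apply: VL_le; first by exists phi.
move=> psi [/MC psiC _]; apply: csp_payoff_le => // i j.
by have /andP[] := uL_payoff i j.
Qed.

(** Every other pair trails in [uL] by a positive gap, which outweighs [w] for large [t]; there are
    finitely many pairs. *)
Lemma eventually_pure_maximum w : unique_maximizer uL ->
  exists i j, (forall k l, uL k l <= uL i j) /\
    exists t0 : R, forall t, t0 < t ->
      forall k l, w k l + t * uL k l <= w i j + t * uL i j.
Proof.
move=> [[i j] [/= max uniq]]; exists i, j; split=> //.
have : \forall t \near +oo, forall q : 'I_m * 'I_n,
    w q.1 q.2 + t * uL q.1 q.2 <= w i j + t * uL i j.
  apply: filter_forall => -[k l] /=.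
  have [kl|kl] := eqVneq (uL k l) (uL i j).
    have [<- <-] : (i, j) = (k, l) by apply: uniq => /= a b; rewrite kl.
    exact: nearW.
  have gap : 0 < uL i j - uL k l.
    by rewrite subr_gt0 lt_neqAle kl max.
  apply: filterS (nbhs_pinfty_ge (num_real ((w k l - w i j) / (uL i j - uL k l)))).
  move=> t; rewrite ler_pdivrMr//; lra.
by move=> [t0 [_ H]]; exists t0 => t /H tP k l; exact: tP (k, l).
Qed.

(* In the proof, [D t] is the difference, at the payoff [w + t uL], of the
   support functions of [M'] and [M]; domination is used on a subdivision of
   [0, t] of mesh [d], where the slopes telescope and cost at most [2 d]. *)
Lemma domination_support w M M' (c : R) :
  unique_maximizer uL ->
  closed M -> M `<=` @csp R m n -> closed M' -> M' `<=` @csp R m n ->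
  (forall i j, (forall k l, uL k l <= uL i j) -> M (delta_mx i j)) ->
  (forall u, VL uL M u <= VL uL M' u) ->
  (forall phi, M phi -> payoff w phi <= c) ->
  forall phi, M' phi -> payoff w phi <= c.
Proof.
move=> uniq Mcl MC M'cl M'C Mpure dom Mw phi0 M'phi0.
have [i [j [max [t0 pure]]]] := eventually_pure_maximum w uniq.
have Mij := Mpure _ _ max.
pose v (t : R) i j := w i j + t * uL i j.
have M0 : M !=set0 by exists (delta_mx i j).
have M'0 : M' !=set0 by exists phi0.
have [f fP] := choice (fun t => maximizers_nonempty (v t) M0 Mcl MC).
have [f' f'P] := choice (fun t => maximizers_nonempty (v t) M'0 M'cl M'C).
pose D t := payoff (v t) (f' t) - payoff (v t) (f t).
pose a t := VL uL M (v t).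
have step t d : 0 < d -> D t + d * (a t - a (t + d)) <= D (t + d).
  move=> d0.
  have vd phi : payoff (v (t + d)) phi = payoff (v t) phi + d * payoff uL phi.
    by rewrite !payoff_combine; ring.
  have [Mf fmax] := fP (t + d); have [_ fmaxt] := fP t.
  (* Each maximizer at [t] remains available at [t + d], where it gains [d] times its learner
     payoff. *)
  have slope : d * VL uL M' (v t) <=
      payoff (v (t + d)) (f' (t + d)) - payoff (v t) (f' t).
    rewrite -ler_pdivlMl//; apply: VL_le; first by exists (f' t).
    move=> phi [M'phi phimax]; rewrite ler_pdivlMl//.
    have := (f'P (t + d)).2 _ M'phi; rewrite vd.
    have := phimax _ (f'P t).1; lra.
  (* Conversely the maximizer at [t + d] is tested at [t], which bounds the slope for [M] from
     above. *)
  have slope' : payoff (v (t + d)) (f (t + d)) - payoff (v t) (f t) <=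
      d * a (t + d).
    have : d * payoff uL (f (t + d)) <= d * a (t + d).
      by rewrite ler_pM2l//; exact: payoff_le_VL.
    rewrite vd; have := fmaxt _ Mf; lra.
  have : d * a t <= d * VL uL M' (v t).
    by rewrite ler_pM2l//; exact: dom.
  rewrite /D; lra.
have steps d N : 0 < d -> D 0 + d * (a 0 - a (d *+ N)) <= D (d *+ N).
  move=> d0; elim: N => [|N IH]; first by rewrite mulr0n subrr mulr0 addr0.
  by have := step (d *+ N) d d0; rewrite mulrSr; lra.
(* Beyond [t0] the pure profile in [M] is optimal among all profiles, so [M'] cannot do better. *)
have Dle t : t0 < t -> D t <= 0.
  move=> t0t; rewrite subr_le0 (@le_trans _ _ (v t i j))//.
    apply: csp_payoff_le; first exact/M'C/(proj1 (f'P t)).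
    exact: pure.
  have := (fP t).2 _ Mij; congr (_ <= _).
  rewrite /payoff (bigD1 i)//= (bigD1 j)//= mxE !eqxx mul1r !big1 ?addr0//.
    by move=> k ki; rewrite big1// => l _; rewrite mxE (negbTE ki) mul0r.
  by move=> l lj; rewrite mxE (negbTE lj) andbF mul0r.
have D0 : payoff w phi0 - c <= D 0.
  have v0 phi : payoff (v 0) phi = payoff w phi.
    by rewrite payoff_combine mul0r addr0.
  have := (f'P 0).2 _ M'phi0; have := Mw _ (fP 0).1; rewrite /D !v0; lra.
rewrite leNgt; apply/negP => cphi.
(* Then [D 0] is at least [4 * d]; losing at most [2 * d] leaves [D] positive beyond [t0], a
   contradiction. *)
pose d := (payoff w phi0 - c) / 4.
have d0 : 0 < d by rewrite divr_gt0// subr_gt0.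
pose N := (Num.truncn (`|t0| / d)).+1.
have t0N : t0 < d *+ N.
  rewrite (le_lt_trans (ler_norm _))// -mulr_natr mulrC -ltr_pdivrMr//.
  exact: truncnS_gt.
have := steps d N d0; have := Dle _ t0N.
have /andP[a1 a2] := VL_bounds (v 0) M0 Mcl MC.
have /andP[b1 b2] := VL_bounds (v (d *+ N)) M0 Mcl MC.
have : d * (a 0 - a (d *+ N)) >= d * (- 2) by rewrite ler_pM2l// /a; lra.
have : d * 4 = payoff w phi0 - c by rewrite /d; field.
lra.
Qed.

Lemma delta_csp (i : 'I_m) (j : 'I_n) : csp (delta_mx i j : 'M[R]_(m, n)).
Proof.
have -> : delta_mx i j = pure_reply (delta_mx ord0 i) j :> 'M[R]_(m, n).
  by apply/matrixP => k l; rewrite pure_replyE !mxE eqxx /= -natrM mulnb.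
exact: prod_dist_csp (simplex_delta i) (simplex_delta j).
Qed.

Lemma maximum_no_swap_regret i j :
  (forall k l, uL k l <= uL i j) -> no_swap_regret uL (delta_mx i j).
Proof.
move=> max; apply/no_swap_regretP; split; first exact: delta_csp.
move=> k l; rewrite payoff_regret (bigD1 i)//= big1 => [|i' ii'].
  rewrite addr0 mxE eqxx /=; have [->|_] := eqVneq; last by rewrite mul0r.
  by rewrite mul1r subr_le0.
by rewrite mxE (negbTE ii') mul0r.
Qed.

End ParetoOptimality.

Theorem corollary4p10 (R : realType) (m n : nat) (uL : 'I_m -> 'I_n -> R)
    (uL_payoff : is_payoff uL) (uL_max : unique_maximizer uL)
    (uL_dom : no_weakly_dominated_action uL) :
  asymptotic_menu (nsr_menu uL) /\ pareto_optimal uL (nsr_menu uL).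
Proof.
split.
  apply: asymptotic_nsr_menu => //.
  (* The maximizing pair provides an action of the learner, so [n] is positive. *)
  by have [[_ j] _] := uL_max; exact: leq_ltn_trans (ltn_ord j).
move=> [M' M'menu []]; rewrite nsr_menuE => dom [uO _].
have NC : no_swap_regret uL `<=` @csp R m n by move=> phi /no_swap_regretP [].
have M'N : M' `<=` no_swap_regret uL.
  move=> phi M'phi; apply/no_swap_regretP; split.
    exact: asymptotic_menu_csp M'phi.
  (* Here [w] is the swap regret from [j] to [k] and [c = 0]. *)
  move=> j k; apply: (domination_support uL_payoff uL_max
    (@no_swap_regret_closed R m n uL) NC (proj1 M'menu)
    (asymptotic_menu_csp M'menu) _ (VL_le_all dom) _ M'phi).
    exact: maximum_no_swap_regret.
  by move=> psi /no_swap_regretP [_]; apply.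
have NM' := no_swap_regret_minimal M'menu uL_dom M'N.
have -> : M' = no_swap_regret uL by apply/seteqP; split.
by rewrite ltxx.
Qed.
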